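(* Let $A$ be a pseudo-hoop and let $F$ be a normal filter of $A$. Then $F$ is a fantastic filter of $A$ if and only if the quotient $A/F$ is a Wajsberg pseudo-hoop.
   Context: A pseudo-hoop is an algebra $(A,\odot,\rightarrow,\rightsquigarrow,1)$ of type $(2,2,2,0)$ such that for all $x,y,z\in A$: $x\odot 1=1\odot x=x$; $x\rightarrow x=x\rightsquigarrow x=1$; $(x\odot y)\rightarrow z=x\rightarrow(y\rightarrow z)$; $(x\odot y)\rightsquigarrow z=y\rightsquigarrow(x\rightsquigarrow z)$; $(x\rightarrow y)\odot x=(y\rightarrow x)\odot y=x\odot(x\rightsquigarrow y)=y\odot(y\rightsquigarrow x)$. The order is $x\le y$ iff $x\rightarrow y=1$. Put $x\vee_1 y=(x\rightarrow y)\rightsquigarrow y$, $x\vee_2 y=(x\rightsquigarrow y)\rightarrow y$. $A$ is Wajsberg if $x\vee_1 y=y\vee_1 x$ and $x\vee_2 y=y\vee_2 x$ for all $x,y$. A filter is a nonempty $F\subseteq A$ closed under $\odot$ and upward closed; it is normal if for all $x,y$: $x\rightarrow y\in F$ iff $x\rightsquigarrow y\in F$; it is fantastic if for all $x,y\in A$: $y\rightarrow x\in F$ implies $x\vee_1 y\rightarrow x\in F$, and $y\rightsquigarrow x\in F$ implies $x\vee_2 y\rightsquigarrow x\in F$. For a normal filter $F$, the relation $(x,y)\in\Theta_F$ iff $x\rightarrow y\in F$ and $y\rightarrow x\in F$ is a congruence, and $A/F$ is the quotient pseudo-hoop $A/\Theta_F$. *)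

(* Defs.v *)
From HB Require Import structures.
#[warnings="-notation-overridden"]
From mathcomp Require Import all_boot.
From mathcomp Require Import boolp classical_sets.

Set Implicit Arguments.
Unset Strict Implicit.
Unset Printing Implicit Defensive.

Declare Scope hoop_scope.
Delimit Scope hoop_scope with hoop.
Local Open Scope quotient_scope.
Local Open Scope hoop_scope.

Reserved Notation "x ⊙ y" (at level 40, left associativity).
Reserved Notation "x → y" (at level 55, right associativity).
Reserved Notation "x ⇝ y" (at level 55, right associativity).
Reserved Notation "x ∨₁ y" (at level 50, left associativity).
Reserved Notation "x ∨₂ y" (at level 50, left associativity).

HB.mixin Record isPseudoHoop (A : Type) := {
  hmul : A -> A -> A;
  himp : A -> A -> A;
  himp' : A -> A -> A;
  hone : A;
  hmulx1 : forall x, hmul x hone = x;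
  hmul1x : forall x, hmul hone x = x;
  himpxx : forall x, himp x x = hone;
  himp'xx : forall x, himp' x x = hone;
  himpM : forall x y z, himp (hmul x y) z = himp x (himp y z);
  himp'M : forall x y z, himp' (hmul x y) z = himp' y (himp' x z);
  hdivC : forall x y, hmul (himp x y) x = hmul (himp y x) y;
  hdiv_div' : forall x y, hmul (himp y x) y = hmul x (himp' x y);
  hdiv'C : forall x y, hmul x (himp' x y) = hmul y (himp' y x)
}.

#[short(type="pseudoHoopType")]
HB.structure Definition PseudoHoop := { A of isPseudoHoop A }.

Notation "x ⊙ y" := (hmul x y) : hoop_scope.
Notation "x → y" := (himp x y) : hoop_scope.
Notation "x ⇝ y" := (himp' x y) : hoop_scope.
Notation "1" := hone : hoop_scope.

Definition hle (A : pseudoHoopType) (x y : A) : Prop := x → y = 1.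

Definition hjoin1 (A : pseudoHoopType) (x y : A) : A := (x → y) ⇝ y.
Definition hjoin2 (A : pseudoHoopType) (x y : A) : A := (x ⇝ y) → y.

Notation "x ∨₁ y" := (hjoin1 x y) : hoop_scope.
Notation "x ∨₂ y" := (hjoin2 x y) : hoop_scope.

Definition wajsberg (A : pseudoHoopType) : Prop :=
  (forall x y : A, x ∨₁ y = y ∨₁ x) /\ (forall x y : A, x ∨₂ y = y ∨₂ x).

Definition hfilter (A : pseudoHoopType) (F : set A) : Prop :=
  [/\ exists x, F x,
      forall x y, F x -> F y -> F (x ⊙ y)
    & forall x y, F x -> hle x y -> F y].

Definition normal_hfilter (A : pseudoHoopType) (F : set A) : Prop :=
  hfilter F /\ forall x y, F (x → y) <-> F (x ⇝ y).

Definition fantastic_hfilter (A : pseudoHoopType) (F : set A) : Prop :=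
  hfilter F /\
  forall x y, (F (y → x) -> F ((x ∨₁ y) → x)) /\
              (F (y ⇝ x) -> F ((x ∨₂ y) ⇝ x)).

Section PseudoHoopTheory.
Variable A : pseudoHoopType.
Implicit Types x y z : A.

Lemma hle_antisym x y : hle x y -> hle y x -> x = y.
Proof. by rewrite /hle => xy yx; move: (hdivC x y); rewrite xy yx !hmul1x. Qed.

Lemma hmulA x y z : x ⊙ (y ⊙ z) = x ⊙ y ⊙ z.
Proof. by apply: hle_antisym; rewrite /hle; [rewrite -(himpxx (x ⊙ y ⊙ z))
  |rewrite -(himpxx (x ⊙ (y ⊙ z)))]; rewrite !himpM. Qed.

Lemma himp1_imp x z : 1 → (x → z) = x → z.
Proof. by rewrite -himpM hmul1x. Qed.

Lemma himp1x x : 1 → x = x.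
Proof.
have Eb : 1 → x = (x → 1) ⊙ x by rewrite hdivC hmulx1.
have xb : x → (1 → x) = 1 by rewrite -himpM hmulx1 himpxx.
have Ea : (x → 1) → 1 = (1 → x) → x by rewrite Eb himpM himpxx.
have Ex : x = ((1 → x) → x) ⊙ (1 → x) by rewrite -hdivC xb hmul1x.
rewrite -Ea Eb hmulA hdivC hmulx1 himp1_imp in Ex.
by rewrite Eb -Ex.
Qed.

Lemma hlex1 x : hle x 1.
Proof.
have : (1 → x) → (1 → 1) = 1 by rewrite -himpM hdivC himpM himpxx.
by rewrite himp1x himpxx.
Qed.

Lemma hle_trans y x z : hle x y -> hle y z -> hle x z.
Proof.
rewrite /hle => xy yz; have <- : (y → x) ⊙ y = x by rewrite hdivC xy hmul1x.
by rewrite himpM yz; exact: hlex1.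
Qed.

Lemma hleE' x y : hle x y <-> x ⇝ y = 1.
Proof.
rewrite /hle; split=> h.
  have Ex : x = x ⊙ (x ⇝ y) by rewrite -hdiv_div' -hdivC h hmul1x.
  by rewrite {1}Ex himp'M himp'xx.
have Ex : x = (x → y) ⊙ x by rewrite hdivC hdiv_div' h hmulx1.
by rewrite {1}Ex himpM himpxx.
Qed.

Lemma hle_mulr x y z : hle (x ⊙ y) z <-> hle x (y → z).
Proof. by rewrite /hle himpM. Qed.

Lemma hle_mull x y z : hle (x ⊙ y) z <-> hle y (x ⇝ z).
Proof. by rewrite !hleE' himp'M. Qed.

Lemma hlexx x : hle x x. Proof. exact: himpxx. Qed.

Lemma hle_mul2r z x y : hle x y -> hle (x ⊙ z) (y ⊙ z).
Proof. by move=> xy; apply/hle_mulr/(hle_trans xy)/hle_mulr/hlexx. Qed.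

Lemma hle_mul2l z x y : hle x y -> hle (z ⊙ x) (z ⊙ y).
Proof. by move=> xy; apply/hle_mull/(hle_trans xy)/hle_mull/hlexx. Qed.

Lemma himp_mp x y : hle ((x → y) ⊙ x) y.
Proof. exact/hle_mulr/hlexx. Qed.

Lemma himp'_mp x y : hle (x ⊙ (x ⇝ y)) y.
Proof. exact/hle_mull/hlexx. Qed.

Lemma himp_comp x y z : hle ((y → z) ⊙ (x → y)) (x → z).
Proof.
apply: (proj1 (hle_mulr _ _ _)); rewrite -hmulA.
exact/(hle_trans (hle_mul2l _ (himp_mp _ _)))/himp_mp.
Qed.

Lemma himp'_comp x y z : hle ((x ⇝ y) ⊙ (y ⇝ z)) (x ⇝ z).
Proof.
apply: (proj1 (hle_mull _ _ _)); rewrite hmulA.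
exact/(hle_trans (hle_mul2r _ (himp'_mp _ _)))/himp'_mp.
Qed.

End PseudoHoopTheory.

Section QuotientRelation.
Variables (A : pseudoHoopType) (F : set A).
Implicit Types x y z : A.

Definition htheta (x y : A) : Prop := F (x → y) /\ F (y → x).

Hypothesis nF : normal_hfilter F.

Lemma hfilter_le x y : hle x y -> F x -> F y.
Proof. by case: nF => -[_ _ up] _ xy Fx; exact: up xy. Qed.

Lemma hfilterM x y : F x -> F y -> F (x ⊙ y).
Proof. by case: nF => -[_ + _] _; apply. Qed.

Lemma hfilter1 : F 1.
Proof. by case: nF => -[[x Fx] _ _] _; apply: hfilter_le Fx; exact: hlex1. Qed.

Lemma hfilter_normal x y : F (x → y) <-> F (x ⇝ y).
Proof. by case: nF. Qed.

Lemma htheta_refl x : htheta x x.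
Proof. by rewrite /htheta himpxx; split; exact: hfilter1. Qed.

Lemma htheta_sym x y : htheta x y -> htheta y x.
Proof. by case. Qed.

Lemma htheta_trans y x z : htheta x y -> htheta y z -> htheta x z.
Proof.
by move=> [xy yx] [yz zy]; split; apply: (hfilter_le (himp_comp _ y _));
  exact: hfilterM.
Qed.

Lemma htheta_mul x x' y y' :
  htheta x x' -> htheta y y' -> htheta (x ⊙ y) (x' ⊙ y').
Proof.
have Hr u v w : F (u → v) -> F ((u ⊙ w) → (v ⊙ w)).
  rewrite himpM; apply: hfilter_le; apply/hle_mulr.
  exact: (hle_trans (himp_mp _ _) (proj1 (hle_mulr _ _ _) (hlexx _))).
have Hl u v w : F (u → v) -> F ((w ⊙ u) → (w ⊙ v)).
  move/hfilter_normal=> uv; apply/hfilter_normal; move: uv.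
  rewrite himp'M; apply: hfilter_le; apply/hle_mull.
  exact: (hle_trans (himp'_mp _ _) (proj1 (hle_mull _ _ _) (hlexx _))).
move=> [xx' x'x] [yy' y'y]; apply: (@htheta_trans (x' ⊙ y)).
  by split; exact: Hr.
by split; exact: Hl.
Qed.

Lemma htheta_imp x x' y y' :
  htheta x x' -> htheta y y' -> htheta (x → y) (x' → y').
Proof.
have Hr u v w : F (u → v) -> F ((w → u) → (w → v)).
  by apply: hfilter_le; apply/hle_mulr/himp_comp.
have Hl u v w : F (u → v) -> F ((v → w) → (u → w)).
  move=> uv; apply/hfilter_normal; move: uv.
  by apply: hfilter_le; apply/hle_mull/himp_comp.
move=> [xx' x'x] [yy' y'y]; apply: (@htheta_trans (x' → y)).
  by split; exact: Hl.
by split; exact: Hr.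
Qed.

Lemma htheta_imp' x x' y y' :
  htheta x x' -> htheta y y' -> htheta (x ⇝ y) (x' ⇝ y').
Proof.
have Hr u v w : F (u → v) -> F ((w ⇝ u) → (w ⇝ v)).
  move/hfilter_normal=> uv; apply/hfilter_normal; move: uv.
  by apply: hfilter_le; apply/hle_mull/himp'_comp.
have Hl u v w : F (u → v) -> F ((v ⇝ w) → (u ⇝ w)).
  move/hfilter_normal.
  by apply: hfilter_le; apply/hle_mulr/himp'_comp.
move=> [xx' x'x] [yy' y'y]; apply: (@htheta_trans (x' ⇝ y)).
  by split; exact: Hl.
by split; exact: Hr.
Qed.

(* [generic_quotient] needs a Boolean relation on a choiceType, hence the
   classical copy of the carrier and the reflection of [htheta]. *)
Definition hthetab : rel {classic A} := fun x y => `[< htheta x y >].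

Lemma hthetab_refl : reflexive hthetab.
Proof. by move=> x; apply/asboolP/htheta_refl. Qed.

Lemma hthetab_sym : symmetric hthetab.
Proof. by move=> x y; apply/asboolP/asboolP; exact: htheta_sym. Qed.

Lemma hthetab_trans : transitive hthetab.
Proof.
by move=> y x z /asboolP xy /asboolP yz; apply/asboolP/(htheta_trans xy yz).
Qed.

Canonical htheta_equiv := EquivRel hthetab hthetab_refl hthetab_sym hthetab_trans.

Definition hquot : Type := {eq_quot htheta_equiv}.

Definition hclass (x : A) : hquot := \pi_{eq_quot htheta_equiv} (x : {classic A}).

Definition hrepr (X : hquot) : A := repr (X : {eq_quot htheta_equiv}).

Lemma hreprK X : hclass (hrepr X) = X.
Proof. exact: (@reprK _ {eq_quot htheta_equiv}). Qed.

Lemma hclass_eq x y : hclass x = hclass y <-> htheta x y.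
Proof.
split=> [/(@eqmodP {classic A} htheta_equiv)/asboolP//|xy].
exact/(@eqmodP {classic A} htheta_equiv)/asboolP.
Qed.

Lemma hclassK x : htheta (hrepr (hclass x)) x.
Proof. by apply/hclass_eq; rewrite hreprK. Qed.

Definition hquot_mul (X Y : hquot) : hquot := hclass (hrepr X ⊙ hrepr Y).
Definition hquot_imp (X Y : hquot) : hquot := hclass (hrepr X → hrepr Y).
Definition hquot_imp' (X Y : hquot) : hquot := hclass (hrepr X ⇝ hrepr Y).
Definition hquot_one : hquot := hclass 1.

Lemma hclassM x y : hquot_mul (hclass x) (hclass y) = hclass (x ⊙ y).
Proof. exact/hclass_eq/htheta_mul/hclassK/hclassK. Qed.

Lemma hclass_imp x y : hquot_imp (hclass x) (hclass y) = hclass (x → y).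
Proof. exact/hclass_eq/htheta_imp/hclassK/hclassK. Qed.

Lemma hclass_imp' x y : hquot_imp' (hclass x) (hclass y) = hclass (x ⇝ y).
Proof. exact/hclass_eq/htheta_imp'/hclassK/hclassK. Qed.

Let hclassE := (hclassM, hclass_imp, hclass_imp').

Fact hquot_mulx1 X : hquot_mul X hquot_one = X.
Proof. by rewrite -(hreprK X) hclassM hmulx1. Qed.

Fact hquot_mul1x X : hquot_mul hquot_one X = X.
Proof. by rewrite -(hreprK X) hclassM hmul1x. Qed.

Fact hquot_impxx X : hquot_imp X X = hquot_one.
Proof. by rewrite -(hreprK X) hclass_imp himpxx. Qed.

Fact hquot_imp'xx X : hquot_imp' X X = hquot_one.
Proof. by rewrite -(hreprK X) hclass_imp' himp'xx. Qed.

Fact hquot_impM X Y Z :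
  hquot_imp (hquot_mul X Y) Z = hquot_imp X (hquot_imp Y Z).
Proof. by rewrite -(hreprK X) -(hreprK Y) -(hreprK Z) !hclassE himpM. Qed.

Fact hquot_imp'M X Y Z :
  hquot_imp' (hquot_mul X Y) Z = hquot_imp' Y (hquot_imp' X Z).
Proof. by rewrite -(hreprK X) -(hreprK Y) -(hreprK Z) !hclassE himp'M. Qed.

Fact hquot_divC X Y :
  hquot_mul (hquot_imp X Y) X = hquot_mul (hquot_imp Y X) Y.
Proof. by rewrite -(hreprK X) -(hreprK Y) !hclassE hdivC. Qed.

Fact hquot_div_div' X Y :
  hquot_mul (hquot_imp Y X) Y = hquot_mul X (hquot_imp' X Y).
Proof. by rewrite -(hreprK X) -(hreprK Y) !hclassE hdiv_div'. Qed.

Fact hquot_div'C X Y :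
  hquot_mul X (hquot_imp' X Y) = hquot_mul Y (hquot_imp' Y X).
Proof. by rewrite -(hreprK X) -(hreprK Y) !hclassE hdiv'C. Qed.

HB.instance Definition _ := isPseudoHoop.Build hquot
  hquot_mulx1 hquot_mul1x hquot_impxx hquot_imp'xx hquot_impM hquot_imp'M
  hquot_divC hquot_div_div' hquot_div'C.

End QuotientRelation.

(* Main.v *)
(** In any pseudo-hoop [y ∨₁ x] is antitone in [y → x], and [x ∨₁ y] is an upper
    bound of [x] and [y].  So if [u ∨₁ x = u] whenever [x <= u], taking
    [u = x ∨₁ y] gives [y ∨₁ x <= u ∨₁ x = u = x ∨₁ y], hence commutativity by
    symmetry; the same holds for [∨₂].  For a normal filter, [F (x → y)],
    equivalently [F (x ⇝ y)], means that the class of [x] is below that of [y],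
    so being fantastic is exactly this condition in the quotient. *)
Require Import Defs.
From mathcomp Require Import all_boot.
From mathcomp Require Import boolp classical_sets.

Set Implicit Arguments.
Unset Strict Implicit.
Unset Printing Implicit Defensive.

Local Open Scope hoop_scope.

Section Joins.
Variable A : pseudoHoopType.
Implicit Types x y z : A.

(** Divisibility turns [1 ⊙ (1 ⇝ x)] into [(x → 1) ⊙ x], and [x → 1 = 1]. *)
Lemma himp'1x x : 1 ⇝ x = x.
Proof. by rewrite -[LHS]hmul1x -hdiv_div' (hlex1 x : x → 1 = 1) hmul1x. Qed.

Lemma hle_imp2r z x y : hle x y -> hle (y → z) (x → z).
Proof.
by move=> xy; apply/hle_mulr/(hle_trans (hle_mul2l _ xy))/himp_mp.
Qed.

Lemma hle_imp'2r z x y : hle x y -> hle (y ⇝ z) (x ⇝ z).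
Proof.
by move=> xy; apply/hle_mull/(hle_trans (hle_mul2r _ xy))/himp'_mp.
Qed.

Lemma hle_join1l x y : hle x (x ∨₁ y).
Proof. exact/hle_mull/himp_mp. Qed.

Lemma hle_join1r x y : hle y (x ∨₁ y).
Proof. by apply/hle_mull/hle_mulr; rewrite himpxx; exact: hlex1. Qed.

Lemma hle_join2l x y : hle x (x ∨₂ y).
Proof. exact/hle_mulr/himp'_mp. Qed.

Lemma hle_join2r x y : hle y (x ∨₂ y).
Proof. by apply/hle_mulr/hle_mull; rewrite himp'xx; exact: hlex1. Qed.

Lemma hjoin1_id x y : hle x y -> x ∨₁ y = y.
Proof. by rewrite /hjoin1 => ->; exact: himp'1x. Qed.

Lemma hjoin2_id x y : hle x y -> x ∨₂ y = y.
Proof. by rewrite /hjoin2 => /hleE' ->; exact: himp1x. Qed.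

Lemma wajsberg_leP :
  wajsberg A <->
  forall x y, hle y x -> hle (x ∨₁ y) x /\ hle (x ∨₂ y) x.
Proof.
split=> [[C1 C2] x y yx|H].
  by rewrite C1 C2 hjoin1_id// hjoin2_id//; split; exact: hlexx.
have le1 x y : hle (y ∨₁ x) (x ∨₁ y).
  apply: hle_trans (proj1 (H _ _ (hle_join1l x y))).
  (* Two antitone steps make [∨₁] monotone on the left; [y] is raised to [x ∨₁ y]. *)
  exact/hle_imp'2r/hle_imp2r/hle_join1r.
have le2 x y : hle (y ∨₂ x) (x ∨₂ y).
  apply: hle_trans (proj2 (H _ _ (hle_join2l x y))).
  exact/hle_imp2r/hle_imp'2r/hle_join2r.
by split=> x y; apply: hle_antisym.
Qed.

End Joins.

Section QuotientOrder.
Variables (A : pseudoHoopType) (F : set A) (nF : normal_hfilter F).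
Implicit Types x y : A.

(** Being below in the quotient means [x → y] is congruent to [1]. One half of that congruence is
    automatic, since [(x → y) → 1 = 1]; the other is [1 → (x → y) = x → y]. *)
Lemma hle_hclass x y : hle (hclass nF x) (hclass nF y) <-> F (x → y).
Proof.
have -> : hle (hclass nF x) (hclass nF y) =
          (hclass nF (x → y) = hclass nF 1) by rewrite -hclass_imp.
split=> [/hclass_eq[_]|Fxy]; first by rewrite himp1x.
apply/hclass_eq; split; last by rewrite himp1x.
by rewrite (hlex1 (x → y) : _ = 1); exact: hfilter1.
Qed.

Lemma hclass_join1 x y : hclass nF x ∨₁ hclass nF y = hclass nF (x ∨₁ y).
Proof. by rewrite /hjoin1 -hclass_imp' -hclass_imp. Qed.

Lemma hclass_join2 x y : hclass nF x ∨₂ hclass nF y = hclass nF (x ∨₂ y).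
Proof. by rewrite /hjoin2 -hclass_imp -hclass_imp'. Qed.

End QuotientOrder.

Theorem theorem4p20 (A : pseudoHoopType) (F : set A) (nF : normal_hfilter F) :
  fantastic_hfilter F <-> wajsberg (hquot nF).
Proof.
rewrite wajsberg_leP; split=> [[_ fF] X Y|H].
  rewrite -(hreprK X) -(hreprK Y) hclass_join1 hclass_join2.
  move=> /hle_hclass yx; have [f1 f2] := fF (hrepr X) (hrepr Y).
  split; apply/hle_hclass; first exact: f1.
  (* [f2] is stated with [⇝], the quotient order with [→]; normality converts both ends. *)
  by apply/(hfilter_normal nF)/f2/(hfilter_normal nF).
split=> [|x y]; first exact: (proj1 nF).
(* [H] at the classes of [x] and [y], pulled back to [F]. *)
have {}H : F (y → x) -> F (x ∨₁ y → x) /\ F (x ∨₂ y → x).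
  by move=> /(hle_hclass nF)/H; rewrite hclass_join1 hclass_join2 !hle_hclass.
by split=> [/H[]//|/(hfilter_normal nF)/H[_ /(hfilter_normal nF)]].
Qed.
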